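(* Let $\mathbb{F}$ be an algebraically closed field of characteristic $p>2$ and let $n\ge 1$. Let $\mathfrak{ba}_n^0$ be the restricted Heisenberg Lie superalgebra with odd center whose basis is $\{x_1,\ldots,x_n\mid y_1,\ldots,y_n,y_{n+1}\}$ (the $x_i$ even, the $y_j$ odd), whose non-zero brackets of basis elements are given by $[x_i,y_i]=y_{n+1}$ for $1\le i\le n$ (together with those forced by super-antisymmetry), and whose $[p]$-operator is $[p]=0$. Let $\delta_{1,n}=1$ if $n=1$ and $\delta_{1,n}=0$ otherwise. Then the restricted 2-cohomology space with trivial coefficients has superdimension $$\mathrm{sdim}\, H^2_{res}(\mathfrak{ba}_n^0)=(n^2+n,\ n^2-1+\delta_{1,n}),$$ and a basis of $H^2_{res}(\mathfrak{ba}_n^0)$ consists of the classes of the cocycles $$\{(x^{i,j},\widetilde{x^{i,j}})\mid 1\le i<j\le n\}\ \cup\ \{(y^{i,j},\widetilde{y^{i,j}})\mid 1\le i\le j\le n\}\ \cup\ \{(0,\overline{x}^i)\mid 1\le i\le n\}$$ $$\cup\ \{(x^j\wedge y^i,\widetilde{x^j\wedge y^i})\mid 1\le i<j\le n\}\ \cup\ \{(x^i\wedge y^i,\widetilde{x^i\wedge y^i})\mid 1\le i\le n-1\}$$ $$\cup\ \{(x^1\wedge y^i,\widetilde{x^1\wedge y^i})\mid 2\le i\le n\}\ \cup\ \{(x^i\wedge y^j,\widetilde{x^i\wedge y^j})\mid 2\le i<j\le n\},$$ together with, in the case $n=1$ only, the additional cocycle $(x^1\wedge y^2,\widetilde{x^1\wedge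 y^2})$.
   Context: Throughout, $\mathfrak{g}=\mathfrak{g}_{\bar 0}\oplus\mathfrak{g}_{\bar 1}$ is a finite-dimensional Lie superalgebra over $\mathbb{F}$ (for $p=3$ one also requires $[g,[g,g]]=0$ for all $g\in\mathfrak{g}_{\bar 1}$). $|g|$ denotes the parity of a homogeneous element $g$. Iterated brackets are left-normed: $[g_1,g_2,\ldots,g_j]=[[\ldots[[g_1,g_2],g_3],\ldots],g_j]$. Restricted Lie superalgebra: $\mathfrak{g}$ together with a map $[p]:\mathfrak{g}_{\bar 0}\to\mathfrak{g}_{\bar 0}$, $g\mapsto g^{[p]}$, making $\mathfrak{g}_{\bar 0}$ a restricted Lie algebra and such that $\mathfrak{g}_{\bar 1}$ is a restricted $\mathfrak{g}_{\bar 0}$-module under the bracket (i.e. $(\mathrm{ad}\,g)^p$ and $\mathrm{ad}\,g^{[p]}$ agree on $\mathfrak{g}_{\bar 1}$ for $g\in\mathfrak{g}_{\bar 0}$). Ordinary cochains (trivial coefficients): $C^1(\mathfrak{g})=\mathfrak{g}^*$ and $C^q(\mathfrak{g})=(\wedge^q\mathfrak{g})^*$ for $q=2,3$, where $\wedge$ is the super exterior power, so $g\wedge h=-(-1)^{|g||h|}h\wedge g$. For $\psi\in C^1(\mathfrak{g})$, $\varphi\in C^2(\mathfrak{g})$ and homogeneous $g,h,f$: $d^1(\psi)(g\wedge h)=\psi([g,h])$ and $$d^2(\varphi)(g\wedge h\wedge f)=\varphi([g,h]\wedge f)-(-1)^{|f||h|}\varphi([g,f]\wedge h)+(-1)^{|g|(|h|+|f|)}\varphi([h,f]\wedge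 g).$$ Compatibility: for $\varphi\in C^2(\mathfrak{g})$, a map $\omega:\mathfrak{g}_{\bar 0}\to\mathbb{F}$ is $\varphi$-compatible if $\omega(ag)=a^p\omega(g)$ and $$\omega(g+h)=\omega(g)+\omega(h)+\sum_{\substack{g_i\in\{g,h\}\\ g_1=g,\,g_2=h}}\frac{1}{\#(g)}\varphi([g_1,g_2,\ldots,g_{p-1}]\wedge g_p)$$ for all $a\in\mathbb{F}$, $g,h\in\mathfrak{g}_{\bar 0}$, where the sum is over all choices of $g_3,\ldots,g_p$ and $\#(g)$ is the number of factors $g_i$ equal to $g$. Given an ordered basis of $\mathfrak{g}_{\bar 0}$, for each $\varphi$ there is a unique $\varphi$-compatible map vanishing on all basis elements of $\mathfrak{g}_{\bar 0}$; it is denoted $\widetilde{\varphi}$. Here the basis is $x_1,\ldots,x_n$. Restricted cochains: $C^1_{res}(\mathfrak{g})=C^1(\mathfrak{g})$, and $C^2_{res}(\mathfrak{g})=\{(\varphi,\omega)\mid\varphi\in C^2(\mathfrak{g}),\ \omega:\mathfrak{g}_{\bar 0}\to\mathbb{F}\text{ is }\varphi\text{-compatible}\}$. The differential is $d^1_{res}(\psi)=(d^1(\psi),\mathrm{ind}^1(\psi))$ with $\mathrm{ind}^1(\psi)(g)=\psi(g^{[p]})$ for $g\in\mathfrak{g}_{\bar 0}$, and $d^2_{res}(\varphi,\omega)=(d^2(\varphi),\mathrm{ind}^2(\varphi,\omega))$ with $$\mathrm{ind}^2(\varphi,\omega)(g,h)=\varphi(g\wedge h^{[p]})-\varphi([g,\underbrace{h,\ldots,h}_{p-1}]\wedge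 h),\qquad g\in\mathfrak{g},\ h\in\mathfrak{g}_{\bar 0}.$$ Then $H^2_{res}(\mathfrak{g})=\ker(d^2_{res})/\mathrm{im}(d^1_{res})$. The $\mathbb{Z}/2$-grading on $C^2_{res}(\mathfrak{g})$: the even part consists of the $(\varphi,\omega)$ with $\varphi$ even, the odd part of the $(\varphi,0)$ with $\varphi$ odd; $\mathrm{sdim}=(\text{dimension of even part},\text{dimension of odd part})$. Notation for cochains: $x^{i,j}$, $x^i\wedge y^j$, $y^{i,j}$ denote the elements of $C^2(\mathfrak{g})$ dual to the basis elements $x_i\wedge x_j$ ($i<j$), $x_i\wedge y_j$, $y_i\wedge y_j$ ($i\le j$) of $\wedge^2\mathfrak{g}$. The map $\overline{x}^i:\mathfrak{g}_{\bar 0}\to\mathbb{F}$ is $\overline{x}^i\left(\sum_j a_jx_j\right)=a_i^p$. *)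

(* Defs.v *)
From HB Require Import structures.
From mathcomp Require Import all_boot all_order all_algebra.
From mathcomp Require Import boolp classical_sets functions.

Set Implicit Arguments.
Unset Strict Implicit.
Unset Printing Implicit Defensive.

Import GRing.Theory.
Local Open Scope ring_scope.
Local Open Scope quotient_scope.

(* Parities are booleans: [false] is even, [true] is odd; [(-1) ^+ (a * b)%N]
   uses the coercion from [bool] to [nat].  A finite-dimensional superspace is
   an external direct sum [E * O] of its even and odd parts. *)

Section Superspace.
Variables (F : fieldType) (E O : vectType F).

Definition homog (b : bool) (g : E * O) : bool :=
  if b then g.1 == 0 else g.2 == 0.

Definition part (b : bool) (g : E * O) : E * O :=
  if b then (0, g.2) else (g.1, 0).

End Superspace.

(* The axioms below are the right ones in characteristic different from 2. *)
Record lieSuperalgebra (F : fieldType) := LieSuperalgebra {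
  even_part : vectType F;
  odd_part : vectType F;
  bracket : even_part * odd_part -> even_part * odd_part ->
            even_part * odd_part;
  bracket_linear_l : forall h, linear (bracket^~ h);
  bracket_linear_r : forall g, linear (bracket g);
  bracket_homog : forall (a b : bool) g h, homog a g -> homog b h ->
    homog (a (+) b) (bracket g h);
  bracket_skew : forall (a b : bool) g h, homog a g -> homog b h ->
    bracket g h = - ((-1) ^+ (a * b)%N *: bracket h g);
  bracket_jacobi : forall (a b c : bool) g h f,
    homog a g -> homog b h -> homog c f ->
    bracket g (bracket h f) =
      bracket (bracket g h) f + (-1) ^+ (a * b)%N *: bracket h (bracket g f);
  bracket_odd3 : 3%N \in [pchar F] ->
    forall g, homog true g -> bracket g (bracket g g) = 0
}.

Definition lsa_sort (F : fieldType) (g : lieSuperalgebra F) : vectType F :=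
  (even_part g * odd_part g)%type.
Coercion lsa_sort : lieSuperalgebra >-> Vector.type.

Section LieSuperalgebraTheory.
Variables (F : fieldType) (g : lieSuperalgebra F).

Definition ev (x : even_part g) : g := (x, 0).

(* Left-normed bracket of a nonempty sequence. *)
Definition lbracket (s : seq g) : g :=
  foldl (@bracket F g) (head 0 s) (behead s).

(* [jacobson_sum p phi x y] is the sum of [1 / #(x) * phi w] over the words
   w = (g_1, ..., g_p) with letters in {x, y} such that g_1 = x and g_2 = y,
   where #(x) is the number of letters x.  The word is encoded by c, letter i
   being x iff the i-th entry of c is [true]. *)
Definition jacobson_sum (V : lmodType F) (p : nat) (phi : seq g -> V)
    (x y : even_part g) : V :=
  \sum_(c : p.-tuple bool | nth false c 0%N && ~~ nth true c 1%N)
    (count id c)%:R^-1 *: phi [seq (if b then ev x else ev y) | b <- c].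

End LieSuperalgebraTheory.

Record restrictedLieSuperalgebra (F : fieldType) (p : nat) :=
    RestrictedLieSuperalgebra {
  rlsa_lsa :> lieSuperalgebra F;
  pmap : even_part rlsa_lsa -> even_part rlsa_lsa;
  pmap_scale : forall (a : F) x, pmap (a *: x) = a ^+ p *: pmap x;
  (* Jacobson's formula; for odd p its usual form in terms of
     ad(t x + y)^(p-1)(x) expands into left-normed brackets as here. *)
  pmap_add : forall x y,
    ev (pmap (x + y)) =
      ev (pmap x) + ev (pmap y) + jacobson_sum p (@lbracket F rlsa_lsa) x y;
  (* On the even part this is the remaining axiom of a restricted Lie algebra,
     on the odd part it says that the adjoint module is restricted. *)
  pmap_ad : forall x (h : rlsa_lsa),
    bracket (ev (pmap x)) h = iter p (bracket (ev x)) h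
}.

Section Cochains.
Variables (F : fieldType) (p : nat) (g : restrictedLieSuperalgebra F p).
Local Notation g0 := (even_part g).

(* A linear form on the q-th super exterior power of g is a super-alternating
   q-linear form on g; phi(x /\ y) is written [phi x y]. *)
Definition is_cochain2 (phi : g -> g -> F^o) : Prop :=
  [/\ forall y, linear (phi^~ y), forall x, linear (phi x) &
      forall (a b : bool) x y, homog a x -> homog b y ->
        phi x y = - ((-1) ^+ (a * b)%N * phi y x)].

Definition compatible (phi : g -> g -> F^o) (om : g0 -> F^o) : Prop :=
  (forall (a : F) x, om (a *: x) = a ^+ p * om x) /\
  (forall x y, om (x + y) = om x + om y +
     jacobson_sum p (fun w => phi (lbracket (take p.-1 w)) (nth 0 w p.-1)) x y).

(* The phi-compatible map vanishing on the basis b of the even part. *)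
Definition tilde_map n (b : n.-tuple g0) (phi : g -> g -> F^o) : g0 -> F^o :=
  xget 0 [set om | compatible phi om /\ forall i, om (tnth b i) = 0].

Definition d1 (psi : g -> F^o) : g -> g -> F^o :=
  fun x y => psi (bracket x y).

Definition ind1 (psi : g -> F^o) : g0 -> F^o := fun x => psi (ev (pmap x)).

(* The formula for homogeneous arguments, extended trilinearly. *)
Definition d2 (phi : g -> g -> F^o) : g -> g -> g -> F^o :=
  fun x y z => \sum_(a : bool) \sum_(b : bool) \sum_(c : bool)
    let x' := part a x : g in let y' := part b y : g in
    let z' := part c z : g in
    phi (bracket x' y') z'
    - (-1) ^+ (c * b)%N * phi (bracket x' z') y'
    + (-1) ^+ (a * (b + c))%N * phi (bracket y' z') x'.

Definition ind2 (phi : g -> g -> F^o) (om : g0 -> F^o) : g -> g0 -> F^o :=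
  fun x y => phi x (ev (pmap y))
             - phi (lbracket (x :: nseq p.-1 (ev y))) (ev y).

(* The ambient space in which the restricted 2-cochains live. *)
Definition precochain2 : lmodType F :=
  ((g -> g -> F^o) * (g0 -> F^o))%type.

Definition is_cochain2_res (u : precochain2) : Prop :=
  is_cochain2 u.1 /\ compatible u.1 u.2.

Definition d1_res (psi : {linear g -> F^o}) : precochain2 :=
  (d1 psi, ind1 psi).

Definition d2_res (u : precochain2) :
    (g -> g -> g -> F^o) * (g -> g0 -> F^o) :=
  (d2 u.1, ind2 u.1 u.2).

Definition is_even_form (phi : g -> g -> F^o) : Prop :=
  forall (a b : bool) x y, homog a x -> homog b y -> a (+) b -> phi x y = 0.

Definition is_odd_form (phi : g -> g -> F^o) : Prop :=
  forall (a b : bool) x y, homog a x -> homog b y -> ~~ (a (+) b) ->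
    phi x y = 0.

Definition has_parity (b : bool) (u : precochain2) : Prop :=
  if b then is_odd_form u.1 /\ u.2 = 0 else is_even_form u.1.

Definition cocycle2_pred : {pred precochain2} :=
  fun u => `[< is_cochain2_res u /\ d2_res u = 0 >].

Fact jacobson_sum_comb (phi psi : seq g -> F^o) (a : F) x y :
  jacobson_sum p (fun w => a *: phi w + psi w) x y =
  a *: jacobson_sum p phi x y + jacobson_sum p psi x y.
Proof.
rewrite /jacobson_sum scaler_sumr -big_split /=; apply: eq_bigr => c _.
by rewrite scalerDr !scalerA mulrC.
Qed.

Fact compatible_comb phi psi om th (a : F) :
  compatible phi om -> compatible psi th ->
  compatible (a *: phi + psi) (a *: om + th).
Proof.
case=> omZ omD [thZ thD]; split=> [b x|x y] /=.
  rewrite !fctE omZ thZ mulrDr; congr (_ + _).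
  by rewrite /GRing.scale /= mulrCA.
rewrite !fctE omD thD.
have := jacobson_sum_comb
  (fun w => phi (lbracket (take p.-1 w)) (nth 0 w p.-1))
  (fun w => psi (lbracket (take p.-1 w)) (nth 0 w p.-1)) a x y.
rewrite /= => ->.
by rewrite !scalerDr [LHS]addrACA; congr (_ + _); rewrite [LHS]addrACA.
Qed.

Fact cochain2_comb phi psi (a : F) :
  is_cochain2 phi -> is_cochain2 psi -> is_cochain2 (a *: phi + psi).
Proof.
have comb (V : lmodType F) (f h : V -> F^o) :
    linear f -> linear h -> linear (fun x => a *: f x + h x).
  move=> fL hL b x y; rewrite fL hL !scalerDr !scalerA (mulrC a) -!addrA.
  by congr (_ + _); rewrite addrCA.
case=> phil phir phis [psil psir psis]; split=> [y|x|b c x y bx cy].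
- exact: comb (phil y) (psil y).
- exact: comb (phir x) (psir x).
rewrite !fctE (phis _ _ _ _ bx cy) (psis _ _ _ _ bx cy) mulrDr opprD.
by rewrite scalerN; congr (- _ + _); rewrite /GRing.scale /= mulrCA.
Qed.

Fact cocycle2_submod_closed : submod_closed cocycle2_pred.
Proof.
split=> [|a [phi om] [psi th]].
  apply/asboolP; split; first split.
  - split=> [y a u v|x a u v|a b x y _ _].
    + by change ((0 : F^o) = a *: 0 + 0); rewrite scaler0 addr0.
    + by change ((0 : F^o) = a *: 0 + 0); rewrite scaler0 addr0.
    by change ((0 : F) = - ((-1) ^+ (a * b)%N * 0)); rewrite mulr0 oppr0.
  - split=> [a x|x y].
      by change ((0 : F) = a ^+ p * 0); rewrite mulr0.
    change ((0 : F^o) = 0 + 0 + jacobson_sum p (fun=> (0 : F^o)) x y).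
    by rewrite !add0r /jacobson_sum big1 // => c _; rewrite scaler0.
  congr (_, _); apply/funext => x; apply/funext => y.
    apply/funext => z; rewrite /d2 big1 // => a _; rewrite big1 // => b _.
    by rewrite big1 // => c _; rewrite /= !mulr0 subr0 addr0.
  by rewrite /ind2 /= subr0.
move=> /asboolP[[phiC omC] phid] /asboolP[[psiC thC] psid].
have -> : a *: (phi, om) + (psi, th) = (a *: phi + psi, a *: om + th)
  :> precochain2 by [].
apply/asboolP; split.
  by split; [apply: (cochain2_comb a phiC psiC) |
             apply: (compatible_comb a omC thC)].
move: phid psid => [d2phi i2phi] [d2psi i2psi].
congr (_, _); apply/funext => x; apply/funext => y.
  apply/funext => z.
  transitivity (a *: d2 phi x y z + d2 psi x y z); last first.
    by rewrite d2phi d2psi scaler0 addr0.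
  do 3!(rewrite /d2 scaler_sumr -big_split /=; apply: eq_bigr => ? _).
  rewrite /= !fctE /GRing.scale /= !mulrDr !mulrN.
  rewrite (mulrCA a) [in RHS](mulrCA a ((-1) ^+ (_ * (_ + _))%N)) opprD.
  by rewrite [RHS]addrACA; congr (_ + _); rewrite [RHS]addrACA.
transitivity (a *: ind2 phi om x y + ind2 psi th x y); last first.
  by rewrite i2phi i2psi scaler0 addr0.
by rewrite /ind2 scalerBr opprD [RHS]addrACA.
Qed.
HB.instance Definition _ :=
  GRing.isSubmodClosed.Build F precochain2 cocycle2_pred
    cocycle2_submod_closed.

(* ker d2_res *)
Record cocycle2 := Cocycle2 {
  cocycle2_val :> precochain2;
  cocycle2_valP : cocycle2_val \in cocycle2_pred }.
HB.instance Definition _ := [isSub for cocycle2_val].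
HB.instance Definition _ := [Choice of cocycle2 by <:].
HB.instance Definition _ := [SubChoice_isSubLmodule of cocycle2 by <:].

Definition coboundary2_pred : {pred cocycle2} :=
  fun z => `[< exists psi : {linear g -> F^o}, val z = d1_res psi >].

Fact coboundary2_submod_closed : submod_closed coboundary2_pred.
Proof.
split=> [|a z y /asboolP[psi zE] /asboolP[th yE]]; apply/asboolP.
  by exists (\0 : {linear g -> F^o}); rewrite raddf0.
exists ((a \*: psi) \+ th : {linear g -> F^o}).
transitivity (a *: val z + val y); first exact: linearP.
by rewrite zE yE.
Qed.
HB.instance Definition _ :=
  GRing.isSubmodClosed.Build F cocycle2 coboundary2_pred
    coboundary2_submod_closed.

(* ker d2_res / im d1_res *)
Definition H2_res := Quotient.quot coboundary2_pred.
HB.instance Definition _ := GRing.Zmodule.on H2_res.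

Definition H2_class (z : cocycle2) : H2_res := \pi_H2_res z.

Lemma H2_class_eq y z :
  (H2_class y = H2_class z) <-> (y - z \in coboundary2_pred).
Proof. by rewrite Quotient.idealrBE; split=> [?|/eqP//]; apply/eqP. Qed.

Fact H2_class_is_zmod_morphism : zmod_morphism H2_class.
Proof. by move=> y z; rewrite /H2_class raddfB. Qed.
HB.instance Definition _ :=
  GRing.isZmodMorphism.Build cocycle2 H2_res H2_class
    H2_class_is_zmod_morphism.

Definition H2_scale (a : F) (h : H2_res) : H2_res :=
  H2_class (a *: repr h).

Lemma H2_classZ a z : H2_class (a *: z) = H2_scale a (H2_class z).
Proof.
apply/H2_class_eq; rewrite -scalerBr rpredZ //.
by apply/H2_class_eq; rewrite {2}/H2_class reprK.
Qed.

Fact H2_classK h : H2_class (repr h) = h.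
Proof. exact: reprK. Qed.

Fact H2_scaleA a b h : H2_scale a (H2_scale b h) = H2_scale (a * b) h.
Proof. by rewrite -[h]H2_classK -!H2_classZ scalerA. Qed.
Fact H2_scale1 : left_id 1 H2_scale.
Proof. by move=> h; rewrite -[h]H2_classK -H2_classZ scale1r. Qed.
Fact H2_scaleDr : right_distributive H2_scale +%R.
Proof.
move=> a h k; rewrite -[h]H2_classK -[k]H2_classK -raddfD -!H2_classZ.
by rewrite -raddfD scalerDr.
Qed.
Fact H2_scaleDl h : {morph H2_scale^~ h : a b / a + b}.
Proof.
by move=> a b; rewrite -[h]H2_classK -!H2_classZ scalerDl raddfD.
Qed.
HB.instance Definition _ := GRing.Zmodule_isLmodule.Build F H2_res
  H2_scaleA H2_scale1 H2_scaleDr H2_scaleDl.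

Fact H2_class_is_scalable : scalable H2_class.
Proof. exact: H2_classZ. Qed.
HB.instance Definition _ :=
  GRing.isScalable.Build F cocycle2 H2_res *:%R H2_class H2_class_is_scalable.

Definition H2_part (b : bool) : set H2_res :=
  [set h | exists z : cocycle2, has_parity b (val z) /\ h = H2_class z].

End Cochains.

(* [s] is a basis of the linear subspace [W] of [V]. *)
Definition is_basis (F : fieldType) (V : lmodType F) (W : set V) (s : seq V) :
    Prop :=
  [/\ forall v, v \in s -> W v,
      forall c : 'I_(size s) -> F,
        \sum_i c i *: s`_i = 0 -> forall i, c i = 0 &
      forall v, W v -> exists c : 'I_(size s) -> F, v = \sum_i c i *: s`_i].

Definition has_dim (F : fieldType) (V : lmodType F) (W : set V) (d : nat) :
    Prop :=
  exists s : seq V, size s = d /\ is_basis W s.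

Definition sdim_H2_res_is (F : fieldType) (p : nat)
    (g : restrictedLieSuperalgebra F p) (d : nat * nat) : Prop :=
  has_dim (H2_part (g := g) false) d.1 /\ has_dim (H2_part (g := g) true) d.2.

(* The Heisenberg Lie superalgebra with odd center.  Indices are 0-based: the
   basis vector x_(i+1) is [delta_mx 0 i] in the even part 'rV_n, and y_(j+1)
   is [delta_mx 0 j] in the odd part 'rV_n.+1, so that y_(n+1) has index
   [ord_max]. *)
Section Heisenberg.
Variables (F : fieldType) (n : nat).
Local Notation V := ('rV[F]_n * 'rV[F]_n.+1)%type.

Definition ba_form (g h : V) : F :=
  \sum_(i < n) (g.1 0 i * h.2 0 (widen_ord (leqnSn n) i)
                - h.1 0 i * g.2 0 (widen_ord (leqnSn n) i)).

Definition ba_bracket (g h : V) : V :=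
  (0, ba_form g h *: delta_mx 0 ord_max).

Fact ba_form_linear_l h : linear (ba_form^~ h : V -> F^o).
Proof.
move=> a x y; rewrite /ba_form scaler_sumr -big_split; apply: eq_bigr => i _.
rewrite /= !mxE /GRing.scale /= mulrDl mulrDr opprD addrACA -mulrA mulrBr.
by congr (_ - _ + _); rewrite mulrCA.
Qed.

Fact ba_formC g h : ba_form g h = - ba_form h g.
Proof.
by rewrite /ba_form -sumrN; apply: eq_bigr => i _; rewrite opprB.
Qed.

Fact ba_form_linear_r g : linear (ba_form g : V -> F^o).
Proof.
move=> a x y; rewrite ba_formC (ba_form_linear_l g a x y).
by rewrite (ba_formC g x) (ba_formC g y) /GRing.scale /= opprD mulrN.
Qed.

Fact ba_form_center g (v : F) : ba_form (0, v *: delta_mx 0 ord_max) g = 0.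
Proof.
rewrite /ba_form big1 // => i _; rewrite !mxE /= mul0r.
by rewrite -val_eqE /= (ltn_eqF (ltn_ord i)) !mulr0 subr0.
Qed.

Fact ba_bracketA g h f : ba_bracket (ba_bracket g h) f = 0.
Proof. by rewrite /ba_bracket ba_form_center scale0r. Qed.

Fact ba_bracket0 g : ba_bracket 0 g = 0.
Proof.
have -> : 0 = (0, 0 *: delta_mx 0 ord_max) :> V by rewrite scale0r.
by rewrite /ba_bracket ba_form_center !scale0r.
Qed.

Fact ba_bracketC g h : ba_bracket g h = - ba_bracket h g.
Proof. by rewrite /ba_bracket ba_formC scaleNr; congr (_, _); rewrite oppr0. Qed.

Fact ba_bracketA' g h f : ba_bracket f (ba_bracket g h) = 0.
Proof. by rewrite ba_bracketC ba_bracketA oppr0. Qed.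

Fact ba_form_parity a (g h : V) : homog a g -> homog a h -> ba_form g h = 0.
Proof.
rewrite /ba_form /homog.
by case: a => /eqP g0 /eqP h0; rewrite g0 h0 big1 // => i _;
   rewrite !mxE ?mul0r ?mulr0 subr0.
Qed.

Fact ba_bracket_linear_l h : linear (ba_bracket^~ h).
Proof.
move=> a x y; rewrite /ba_bracket (ba_form_linear_l h a x y).
by rewrite scalerDl -scalerA; congr (_, _); rewrite /= scaler0 addr0.
Qed.

Fact ba_bracket_linear_r g : linear (ba_bracket g).
Proof.
move=> a x y; rewrite /ba_bracket (ba_form_linear_r g a x y).
by rewrite scalerDl -scalerA; congr (_, _); rewrite /= scaler0 addr0.
Qed.

Fact ba_bracket_homog (a b : bool) g h : homog a g -> homog b h ->
  homog (a (+) b) (ba_bracket g h).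
Proof.
case: (altP (a =P b)) => [<- ga ha | ab _ _].
  by rewrite addbb /homog /= (ba_form_parity ga ha) scale0r.
have -> : a (+) b = true by case: a b ab => [] [].
by rewrite /homog /= eqxx.
Qed.

Fact ba_bracket_skew (a b : bool) g h : homog a g -> homog b h ->
  ba_bracket g h = - ((-1) ^+ (a * b)%N *: ba_bracket h g).
Proof.
case: a b => [] [] ga hb; rewrite ?expr0 ?scale1r; try exact: ba_bracketC.
rewrite /ba_bracket (ba_form_parity ga hb) (ba_form_parity hb ga) !scale0r.
by rewrite scaler0 oppr0.
Qed.

Fact ba_bracket_jacobi (a b c : bool) g h f :
  homog a g -> homog b h -> homog c f ->
  ba_bracket g (ba_bracket h f) =
    ba_bracket (ba_bracket g h) f
    + (-1) ^+ (a * b)%N *: ba_bracket h (ba_bracket g f).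
Proof. by move=> *; rewrite ba_bracketA !ba_bracketA' scaler0 addr0. Qed.

Fact ba_bracket_odd3 : 3%N \in [pchar F] ->
  forall g, homog true g -> ba_bracket g (ba_bracket g g) = 0.
Proof. by move=> _ g _; rewrite ba_bracketA'. Qed.

Definition ba_lsa : lieSuperalgebra F :=
  LieSuperalgebra ba_bracket_linear_l ba_bracket_linear_r ba_bracket_homog
    ba_bracket_skew ba_bracket_jacobi ba_bracket_odd3.

Variables (p : nat) (charF : p \in [pchar F]).

Definition ba_pmap (x : even_part ba_lsa) : even_part ba_lsa := 0.

Fact ba_pmap_scale (a : F) x : ba_pmap (a *: x) = a ^+ p *: ba_pmap x.
Proof. by rewrite /ba_pmap scaler0. Qed.

Fact ba_pmap_add x y : ev (ba_pmap (x + y)) =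
  ev (ba_pmap x) + ev (ba_pmap y) + jacobson_sum p (@lbracket F ba_lsa) x y.
Proof.
have p1 := prime_gt1 (pcharf_prime charF).
rewrite /jacobson_sum big1 => [|[c /= /eqP cp] /andP[]]; last first.
  case: c cp p1 => [|a [|b c]] /= <- // _ -> /negPf->.
  suff -> : lbracket (g := ba_lsa) [:: ev x, ev y &
      [seq (if b then ev x else ev y) | b <- c]] = 0 by rewrite scaler0.
  rewrite /lbracket /=.
  have -> : ba_bracket (x, 0) (y, 0) = 0.
    by rewrite /ba_bracket (@ba_form_parity false) ?/homog //= scale0r.
  elim: c => //= d c IHc.
  by rewrite ba_bracket0.
by rewrite addr0 /ev /ba_pmap; congr (_, _); rewrite /= addr0.
Qed.

Fact ba_pmap_ad x (h : ba_lsa) :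
  bracket (ev (ba_pmap x)) h = iter p (bracket (ev x)) h.
Proof.
have := prime_gt1 (pcharf_prime charF).
case: p => [|[|q]] // _; rewrite !iterS /= ba_bracketA'.
exact: ba_bracket0.
Qed.

Definition ba0 : restrictedLieSuperalgebra F p :=
  RestrictedLieSuperalgebra ba_pmap_scale ba_pmap_add ba_pmap_ad.

Definition ba_x : n.-tuple (even_part ba0) :=
  [tuple (delta_mx 0 i : 'rV[F]_n) | i < n].

(* The elements of C^2 dual to the basis x_i /\ x_j (i < j), x_i /\ y_j,
   y_i /\ y_j (i <= j) of the super exterior square.  Odd elements commute
   there, and y_i /\ y_i is a basis element on which y^{i,i} takes the
   value 1. *)
Definition xx_form (i j : 'I_n) : ba0 -> ba0 -> F^o :=
  fun g h => g.1 0 i * h.1 0 j - g.1 0 j * h.1 0 i.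

Definition xy_form (i : 'I_n) (j : 'I_n.+1) : ba0 -> ba0 -> F^o :=
  fun g h => g.1 0 i * h.2 0 j - g.2 0 j * h.1 0 i.

Definition yy_form (i j : 'I_n.+1) : ba0 -> ba0 -> F^o :=
  fun g h => if i == j then g.2 0 i * h.2 0 i
             else g.2 0 i * h.2 0 j + g.2 0 j * h.2 0 i.

Definition xbar (i : 'I_n) : even_part ba0 -> F^o := fun x => x 0 i ^+ p.

Definition with_tilde (phi : ba0 -> ba0 -> F^o) : precochain2 ba0 :=
  (phi, tilde_map ba_x phi).

(* In each of the lists below the 0-based i, j stand for the indices i + 1,
   j + 1 of the basis vectors. *)
Definition xx_cocycles : seq (precochain2 ba0) :=
  [seq with_tilde (xx_form i j)
     | i <- enum 'I_n, j <- [seq j : 'I_n <- enum 'I_n | (i < j)%N]].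

Definition yy_cocycles : seq (precochain2 ba0) :=
  [seq with_tilde (yy_form i j)
     | i <- enum 'I_n.+1, j <- [seq j : 'I_n.+1 <- enum 'I_n.+1 | (i <= j < n)%N]].

Definition xbar_cocycles : seq (precochain2 ba0) :=
  [seq (0, xbar i) | i <- enum 'I_n].

Definition xy_cocycles (P : nat -> nat -> bool) : seq (precochain2 ba0) :=
  [seq with_tilde (xy_form i j)
     | i <- enum 'I_n, j <- [seq j : 'I_n.+1 <- enum 'I_n.+1 | P i j]].

Definition ba0_cocycles : seq (precochain2 ba0) :=
  xx_cocycles ++ yy_cocycles ++ xbar_cocycles
  ++ xy_cocycles (fun i j => j < i)%N
  ++ xy_cocycles (fun i j => (i == j) && (i.+1 < n))%N
  ++ xy_cocycles (fun i j => (i == 0) && (0 < j < n))%N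
  ++ xy_cocycles (fun i j => [&& 0 < i, i < j & j < n])%N
  ++ (if n == 1%N then xy_cocycles (fun i j => (i == 0) && (j == 1))%N else [::]).

End Heisenberg.

(* Main.v *)
From HB Require Import structures.
Require Import Defs.
From mathcomp Require Import all_boot all_order all_algebra.
From mathcomp Require Import boolp classical_sets functions.
From mathcomp Require Import zify ring.

Set Implicit Arguments.
Unset Strict Implicit.
Unset Printing Implicit Defensive.

Import GRing.Theory.

(** The bracket of the Heisenberg superalgebra takes values in the odd center,
    which is spanned by [z = y_(n+1)], and is zero between even elements.  As
    [p - 1 >= 2], all iterated brackets that enter the restricted structure
    vanish ([compatibleP], [ind2_eq0]): a restricted 2-cochain is an ordinary
    one together with an arbitrary p-semilinear map, all the maps written with
    a tilde are zero ([tilde_map_eq0]), and a restricted cocycle is an ordinary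
    cocycle together with a p-semilinear map, a combination of the [xbar i].

    Since only brackets into the center occur in the differential, every form
    with [z] in its radical is a cocycle ([cocycle_central]).  Conversely, the
    cocycle condition on [x_i, y_i, y_k] forces [phi (z, y_k) = 0], because 2
    is invertible, and the condition on [x_i, x_k, y_k] with [i != k] forces
    [phi (x_i, z) = 0].  The latter requires two different indices, and for
    [n = 1] the form dual to [x_1 /\ z] is indeed a cocycle ([xy_cocycle]).
    So cocycles are spanned by the forms dual to the pairs [x_i, x_j],
    [y_i, y_j] and [x_i, y_j] with [i, j <= n] throughout, the maps [xbar i],
    and for [n = 1] this exceptional form.

    The p-map being zero, a linear form [psi] has differential
    [psi z] times the sum of the forms dual to the pairs [x_i, y_i], with zero
    second component: there is one coboundary up to a scalar, it is odd, and it
    allows one to drop the form dual to [x_n /\ y_n].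

    To turn this into a basis, linear coordinates on the cocycles are defined
    that vanish on the coboundary and are dual to the listed cocycles
    ([coord_coboundary], [precoord_dual]).  A cocycle all of whose coordinates
    and whose value at [x_n, y_n] are zero is itself zero ([cocycle_eq0]), so
    every class is the combination of the listed classes given by its
    coordinates ([class_expansion]).  Coordinates of the wrong parity are zero
    on a homogeneous cocycle, which gives the two parts ([part_basis]). *)
Local Open Scope ring_scope.

(** * Bases of a quotient read off from dual coordinates *)

(** This is how a basis of a quotient is recognized without lifting any linear
    form to the quotient: forms [L t] on the source that kill the kernel of
    [pi] are coordinates there, and are enough to read off coefficients. *)
Lemma dual_basis (F : fieldType) (Z Q : lmodType F) (pi : {linear Z -> Q})
    (T : eqType) (z : T -> Z) (L : T -> {linear Z -> F^o}) (W : set Q)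
    (s : seq T) :
  uniq s ->
  (forall t v, pi v = 0 -> L t v = 0) ->
  {in s &, forall t u, L t (z u) = (t == u)%:R} ->
  {in s, forall t, W (pi (z t))} ->
  (forall w, W w ->
     exists2 v, w = pi v & w = \sum_(t <- s) L t v *: pi (z t)) ->
  is_basis W [seq pi (z t) | t <- s].
Proof.
move=> us L0 Lz Wz Wspan.
have sz : size [seq pi (z t) | t <- s] = size s by rewrite size_map.
split=> [v /mapP[t ts ->]|c c0 i|w /Wspan[v wv ->]]; first exact: Wz.
  have t0 : T by case: (s) i => [[]|].
  have is_ j : (nat_of_ord (j : 'I_(size [seq pi (z t) | t <- s])) < size s)%N.
    by rewrite -sz.
  have /(L0 (nth t0 s i)) : pi (\sum_j c j *: z (nth t0 s j)) = 0.
    rewrite linear_sum -[RHS]c0; apply: eq_bigr => j _.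
    by rewrite linearZ (nth_map t0).
  rewrite linear_sum (bigD1 i) //= linearZ Lz ?mem_nth // eqxx big1.
    by rewrite addr0 => ci0; rewrite -ci0 [RHS]mulr1.
  move=> j ij; rewrite linearZ Lz ?mem_nth // nth_uniq // eq_sym.
  by rewrite val_eqE (negPf ij) [LHS]mulr0.
case: s us Lz Wz Wspan sz => [|t0 s] us Lz Wz Wspan sz.
  by exists (fun=> 0); rewrite big_nil big_ord0.
exists (fun i => L (nth t0 (t0 :: s) i) v).
rewrite -(big_mkord xpredT (fun i => L (nth t0 (t0 :: s) i) v *:
   [seq pi (z t) | t <- t0 :: s]`_i)) sz (big_nth t0) !big_mkord.
by apply: eq_bigr => i _; rewrite (nth_map t0).
Qed.

(** * Counting pairs of indices *)

Section Pairs.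
Variables n m : nat.
Implicit Types P Q : nat -> nat -> bool.

Definition pairs P : seq ('I_n * 'I_m) :=
  [seq (i : 'I_n, j : 'I_m)
     | i <- enum 'I_n, j <- [seq j : 'I_m <- enum 'I_m | P i j]].

Lemma mem_pairs P u : (u \in pairs P) = P u.1 u.2.
Proof.
case: u => i j /=; apply/allpairsPdep/idP => [[i' [j' [_ + [-> ->]]]]|Pij].
  by rewrite mem_filter => /andP[].
by exists i, j; split; rewrite ?mem_enum // mem_filter Pij mem_enum.
Qed.

Lemma uniq_pairs P : uniq (pairs P).
Proof.
apply: allpairs_uniq_dep => [|i _|[i j] [i' j'] _ _ [<- <-]] //.
  exact: enum_uniq.
exact/filter_uniq/enum_uniq.
Qed.

Lemma size_pairs P :
  size (pairs P) = (\sum_(i < n) count (P i) (iota 0 m))%N.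
Proof.
rewrite size_allpairs_dep sumnE big_map big_enum /=; apply: eq_bigr => i _.
by rewrite size_filter -val_enum_ord count_map.
Qed.

End Pairs.

Lemma count_interval a b m (P : pred nat) : (b <= m)%N ->
  (forall j, (j < m)%N -> P j = (a <= j < b)%N) ->
  count P (iota 0 m) = (b - a)%N.
Proof.
move=> bm PE; have -> : count P (iota 0 m) = (minn b m - a)%N; last by lia.
elim: m {bm} PE => [|m IHm] PE; first by rewrite minn0.
rewrite -addn1 iotaD count_cat IHm ?add0n /= ?PE; first by lia.
  by [].
by move=> j jm; rewrite PE //; lia.
Qed.

Lemma sum_triangles n :
  (\sum_(i < n) (n - i.+1) + \sum_(i < n.+1) (n - i) = n ^ 2)%N.
Proof.
rewrite big_ord_recr /= subnn addn0 (reindex_inj rev_ord_inj) -big_split /=.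
rewrite (eq_bigr (fun=> n)) => [|i _]; last by have := ltn_ord i; lia.
by rewrite sum_nat_const card_ord mulnn.
Qed.

(** * Labels of the basis cocycles *)

Section Index.
Variable n : nat.

(** The constructors stand for the forms dual to [x_i /\ x_j],
    [y_i /\ y_j] and [x_i /\ y_j], and for the maps [xbar i]. *)
Inductive cocycle_index :=
  | XX of 'I_n & 'I_n | YY of 'I_n.+1 & 'I_n.+1
  | XB of 'I_n | XY of 'I_n & 'I_n.+1.

Definition index_code t :
    'I_n * 'I_n + 'I_n.+1 * 'I_n.+1 + ('I_n + 'I_n * 'I_n.+1) :=
  match t with
  | XX i j => inl (inl (i, j)) | YY i j => inl (inr (i, j))
  | XB i => inr (inl i) | XY i j => inr (inr (i, j))
  end.

Definition index_decode c :=
  match c with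
  | inl (inl (i, j)) => XX i j | inl (inr (i, j)) => YY i j
  | inr (inl i) => XB i | inr (inr (i, j)) => XY i j
  end.

Lemma index_codeK : cancel index_code index_decode. Proof. by case. Qed.
HB.instance Definition _ := Equality.copy cocycle_index (can_type index_codeK).

Definition even_index : seq cocycle_index :=
  [seq XX u.1 u.2 | u <- @pairs n n ltn]
  ++ [seq YY u.1 u.2 | u <- @pairs n.+1 n.+1 (fun i j => i <= j < n)%N]
  ++ [seq XB i | i <- enum 'I_n].

Definition xy_pairs : seq ('I_n * 'I_n.+1) :=
  pairs n n.+1 (fun i j => j < i)%N
  ++ pairs n n.+1 (fun i j => (i == j) && (i.+1 < n))%N
  ++ pairs n n.+1 (fun i j => (i == 0) && (0 < j < n))%N
  ++ pairs n n.+1 (fun i j => [&& 0 < i, i < j & j < n])%N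
  ++ (if n == 1%N then pairs n n.+1 (fun i j => (i == 0) && (j == 1))%N
      else [::]).

Definition odd_index : seq cocycle_index := [seq XY u.1 u.2 | u <- xy_pairs].

(** The indices of the odd classes, without the subdivision that lists them.
    All pairs [x_i, y_j] with [y_j] not central occur but one: the coboundary
    is the sum of the forms dual to the pairs [x_i, y_i], and the last of these
    is dropped.  In dimension [n = 1] the pair of [x_1] with the center also
    carries a cocycle. *)
Definition independent_xy (i j : nat) : bool :=
  (j < n)%N && ~~ ((i == j) && (i.+1 == n)) || (n == 1%N) && (j == 1%N).

Lemma mem_xy_pairs u : (u \in xy_pairs) = independent_xy u.1 u.2.
Proof.
case: u => i j; rewrite /xy_pairs !mem_cat !mem_pairs /=.
rewrite /independent_xy; have := ltn_ord i; have := ltn_ord j.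
by case: (n == 1%N) / eqP => n1; rewrite ?mem_pairs ?in_nil /=; lia.
Qed.

Lemma uniq_xy_pairs : uniq xy_pairs.
Proof.
have disj (P Q : nat -> nat -> bool) : (forall i j, P i j -> ~~ Q i j) ->
    ~~ has (mem (pairs n n.+1 P)) (pairs n n.+1 Q).
  move=> PQ; apply/hasPn => u; rewrite mem_pairs => Qu; apply/negP => /=.
  by rewrite mem_pairs => /PQ; rewrite Qu.
rewrite /xy_pairs; case: (n == 1%N) / eqP => n1;
  rewrite ?cats0 !cat_uniq !has_cat !negb_or !uniq_pairs /= !disj //; lia.
Qed.

Definition index_parity t : bool := if t is XY _ _ then true else false.

Definition valid_index t : bool :=
  match t with
  | XX i j => (i < j)%N | YY i j => (i <= j < n)%N
  | XB i => true | XY i j => independent_xy i j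
  end.

Lemma mem_even_index t :
  (t \in even_index) = valid_index t && ~~ index_parity t.
Proof.
rewrite /even_index !mem_cat andbC; apply/idP/idP.
  case/or3P => /mapP[u + ->] //; rewrite mem_pairs //.
by case: t => [i j|i j|i|i j] //= vt; apply/or3P;
  [apply: Or31; apply/mapP; exists (i, j)
  |apply: Or32; apply/mapP; exists (i, j)
  |apply: Or33; apply: map_f]; rewrite ?mem_pairs ?mem_enum.
Qed.

Lemma mem_odd_index t : (t \in odd_index) = valid_index t && index_parity t.
Proof.
rewrite andbC; apply/mapP/idP => [[u + ->]|]; first by rewrite mem_xy_pairs.
by case: t => // i j vt; exists (i, j); rewrite ?mem_xy_pairs.
Qed.

Lemma mem_index t : (t \in even_index ++ odd_index) = valid_index t.
Proof.
by rewrite mem_cat mem_even_index mem_odd_index -andb_orr orNb andbT.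
Qed.

Lemma uniq_index : uniq (even_index ++ odd_index).
Proof.
rewrite cat_uniq map_inj_uniq ?uniq_xy_pairs; last first.
  by move=> [? ?] [? ?] [-> ->].
have -> : has (mem even_index) odd_index = false.
  apply/hasPn => t; rewrite mem_odd_index => /andP[_ odd_t] /=.
  by rewrite mem_even_index odd_t andbF.
have XXi : injective (fun u : 'I_n * 'I_n => XX u.1 u.2).
  by move=> [? ?] [? ?] [-> ->].
have YYi : injective (fun u : 'I_n.+1 * 'I_n.+1 => YY u.1 u.2).
  by move=> [? ?] [? ?] [-> ->].
have XBi : injective XB by move=> ? ? [].
rewrite !andbT /even_index !cat_uniq (map_inj_uniq XXi) (map_inj_uniq YYi).
rewrite (map_inj_uniq XBi) !uniq_pairs enum_uniq /= andbT.
by apply/andP; split; apply/hasPn => t; rewrite ?mem_cat; [case/orP|];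
  case/mapP => u _ ->; apply/mapP => -[].
Qed.

Lemma size_even_index : size even_index = (n ^ 2 + n)%N.
Proof.
rewrite !size_cat 3!size_map !size_pairs size_enum_ord addnA; congr (_ + _)%N.
rewrite -sum_triangles; congr (_ + _)%N; apply: eq_bigr => i _.
  by apply: count_interval => // j; lia.
by apply: count_interval => // j; lia.
Qed.

(** Row [i] of the table of pairs contributes all of its [n] non-central
    columns, except that the last row loses its diagonal entry. *)
Lemma size_odd_index : (0 < n)%N ->
  size odd_index = (n ^ 2 - 1 + (n == 1%N))%N.
Proof.
move=> n_gt0; rewrite size_map !size_cat !size_pairs !addnA.
congr (_ + _)%N; last first.
  case: eqP => // n1; rewrite size_pairs (eq_bigr (fun=> 1%N)).
    by rewrite sum_nat_const card_ord n1.
  by move=> i _; apply: (@count_interval 1 2) => [|j]; have := ltn_ord i; lia.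
rewrite -!big_split (eq_bigr (fun i : 'I_n => n - (i.+1 == n)))%N => [|i _].
  case: n n_gt0 => // m _; rewrite big_ord_recr /= eqxx.
  rewrite (eq_bigr (fun=> m.+1)) => [|i _]; last by have := ltn_ord i; lia.
  by rewrite sum_nat_const card_ord -mulnn; lia.
have := ltn_ord i => lt_in.
rewrite (@count_interval 0 i); [|lia|lia].
rewrite (@count_interval i (i + (i.+1 < n))); [|lia|lia].
rewrite (@count_interval 1 (if i == 0 :> nat then n else 0));
  [|case: ifP; lia|by move=> j; case: ifP; lia].
rewrite (@count_interval i.+1 (if i == 0 :> nat then 0 else n));
  [|case: ifP; lia|by move=> j; case: ifP; lia].
by move=> /=; case: eqP => i0; lia.
Qed.

End Index.

(** * Restricted cochains of a general algebra *)

Section Cochain.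
Variables (F : fieldType) (p : nat) (g : restrictedLieSuperalgebra F p).
Variables (phi : g -> g -> F^o) (phiC : is_cochain2 phi).

Lemma bracket0l (y : g) : bracket 0 y = 0.
Proof.
have := bracket_linear_l y (-1) 0 0.
by rewrite !scaleN1r oppr0 addr0 addNr.
Qed.

Lemma bracket0r (x : g) : bracket x 0 = 0.
Proof.
have := bracket_linear_r x (-1) 0 0.
by rewrite !scaleN1r oppr0 addr0 addNr.
Qed.

Lemma cochain0l y : phi 0 y = 0.
Proof.
case: phiC => + _ _ => /(_ y (-1) 0 0).
by rewrite !scaleN1r oppr0 addr0 addNr.
Qed.

Lemma cochain0r x : phi x 0 = 0.
Proof.
case: phiC => _ + _ => /(_ x (-1) 0 0).
by rewrite !scaleN1r oppr0 addr0 addNr.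
Qed.

Lemma part_homog a b (x : g) : homog a x -> part b x = if b == a then x else 0.
Proof. by case: x a b => [u v] [] [] /eqP /= ->. Qed.

(** On homogeneous arguments all but one of the eight terms in the trilinear
    extension vanish, which gives back the usual formula. *)
Lemma d2_homog (a b c : bool) (x y z : g) :
  homog a x -> homog b y -> homog c z ->
  d2 phi x y z = phi (bracket x y) z
    - (-1) ^+ (c * b)%N * phi (bracket x z) y
    + (-1) ^+ (a * (b + c))%N * phi (bracket y z) x.
Proof.
move=> hx hy hz; rewrite /d2 (bigD1 a) //= [X in _ + X]big1; last first.
  move=> a' /negPf aa'; rewrite big1 // => b' _; rewrite big1 // => c' _.
  by rewrite (part_homog _ hx) aa' !bracket0l !(cochain0l, cochain0r) !mulr0
     subr0 addr0.
rewrite addr0 (bigD1 b) //= [X in _ + X]big1; last first.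
  move=> b' /negPf bb'; rewrite big1 // => c' _.
  by rewrite (part_homog _ hy) bb' !(bracket0l, bracket0r)
     !(cochain0l, cochain0r) !mulr0 subr0 addr0.
rewrite addr0 (bigD1 c) //= [X in _ + X]big1; last first.
  move=> c' /negPf cc'; rewrite (part_homog _ hz) cc' !bracket0r.
  by rewrite !(cochain0l, cochain0r) !mulr0 subr0 addr0.
by rewrite addr0 (part_homog _ hx) (part_homog _ hy) (part_homog _ hz) !eqxx.
Qed.

End Cochain.

(** * The Heisenberg superalgebra with odd center *)

Section Heisenberg.
Variables (F : fieldType) (p : nat) (charF : p \in [pchar F]).
Hypothesis p_gt2 : (2 < p)%N.
Variable n : nat.
Local Notation G := (ba0 n charF).
Implicit Types (phi : G -> G -> F^o) (om : even_part G -> F^o).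

Definition ybasis (j : 'I_n.+1) : G := (0, delta_mx 0 j).
Definition xbasis (i : 'I_n) : G := ev (delta_mx 0 i : even_part G).
Definition yidx (i : 'I_n) : 'I_n.+1 := widen_ord (leqnSn n) i.

Lemma char_neq2 : (2%:R : F) != 0.
Proof. by rewrite -(dvdn_pcharf charF) gtnNdvd. Qed.

Lemma homog_x i : homog false (xbasis i).
Proof. by rewrite /homog /= eqxx. Qed.
Lemma homog_y j : homog true (ybasis j).
Proof. by rewrite /homog /= eqxx. Qed.

Lemma bracket_xx i j : bracket (xbasis i) (xbasis j) = 0.
Proof.
by rewrite [LHS]/(ba_bracket _ _) /ba_bracket (@ba_form_parity _ _ false)
  ?homog_x // scale0r.
Qed.

Lemma bracket_yy i j : bracket (ybasis i) (ybasis j) = 0.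
Proof.
by rewrite [LHS]/(ba_bracket _ _) /ba_bracket (@ba_form_parity _ _ true)
  ?homog_y // scale0r.
Qed.

Lemma bracket_xy i j :
  bracket (xbasis i) (ybasis j) = if j == yidx i then ybasis ord_max else 0.
Proof.
rewrite [LHS]/(ba_bracket _ _) /ba_bracket /ba_form (bigD1 i) //= big1.
  by rewrite !mxE !eqxx /= addr0 mul0r subr0 mul1r eq_sym;
     case: eqP => _; rewrite ?scale1r ?scale0r.
by move=> k ki; rewrite !mxE eqxx (negPf ki) /= !mul0r subr0.
Qed.

Lemma basis_ext (f : G -> F^o) : linear f ->
  (forall i, f (xbasis i) = 0) -> (forall j, f (ybasis j) = 0) ->
  forall x, f x = 0.
Proof.
move=> fL fx fy [u v].
pose fl : {linear G -> F^o} := HB.pack f (GRing.isLinear.Build F G F^o _ f fL).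
have -> : (u, v) = \sum_i u 0 i *: xbasis i + \sum_j v 0 j *: ybasis j :> G.
  rewrite [LHS]surjective_pairing [RHS]surjective_pairing.
  rewrite !raddfD !raddf_sum /=; congr (_, _).
    rewrite [X in _ + X]big1 => [|j _]; last by rewrite scaler0.
    by rewrite addr0 -row_sum_delta.
  rewrite [X in X + _]big1 => [|j _]; last by rewrite scaler0.
  by rewrite add0r -row_sum_delta.
rewrite -[f]/(fl : G -> F^o) linearD !linear_sum.
by rewrite !big1 ?addr0 // => i _; rewrite linearZ /= ?fx ?fy [LHS]mulr0.
Qed.

Lemma cochain_ext phi : is_cochain2 phi ->
  (forall i j, phi (xbasis i) (xbasis j) = 0) ->
  (forall i j, phi (xbasis i) (ybasis j) = 0) ->
  (forall i j, phi (ybasis i) (ybasis j) = 0) -> phi = 0.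
Proof.
move=> [phil phir phis] xx xy yy; apply/funext => x; apply/funext => y.
apply: (basis_ext (phil y)) => [i|i]; apply: (basis_ext (phir _)) => j //.
by rewrite (phis _ _ _ _ (homog_y i) (homog_x j)) xy mulr0 oppr0.
Qed.

(** Words in even letters have zero bracket as soon as they have two letters,
    and [p - 1 >= 2]; so the correction term in the compatibility condition
    disappears and compatible maps are just the p-semilinear ones. *)
Lemma compatibleP phi om : is_cochain2 phi -> compatible phi om <->
  (forall a x, om (a *: x) = a ^+ p * om x) /\ {morph om : x y / x + y}.
Proof.
move=> phiC; suff J0 x y : jacobson_sum p
    (fun w : seq G => phi (lbracket (take p.-1 w)) (nth 0 w p.-1)) x y = 0.
  rewrite /compatible; split=> -[omZ omD]; split=> // x y.
    by rewrite omD J0 addr0.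
  by rewrite omD J0 addr0.
rewrite /jacobson_sum big1 // => -[c /= /eqP cp] /andP[].
case: c cp p_gt2 => [|a [|b c]] /= <- //= c_gt0 -> /negPf->.
rewrite [lbracket _](_ : _ = 0) ?(cochain0l phiC) ?scaler0 //.
rewrite /lbracket /=; case: c c_gt0 => //= d c _.
rewrite [foldl _ _ _](_ : _ = 0) //.
have -> : ba_bracket (x, 0) (y, 0) = 0 :> G.
  by rewrite /ba_bracket (@ba_form_parity _ _ false) ?/homog //= scale0r.
elim: (take _ _) => //= e s IHs.
by rewrite ba_bracket0.
Qed.

Lemma compatible_eq0 phi om : is_cochain2 phi -> compatible phi om ->
  (forall i, om (delta_mx 0 i : 'rV_n) = 0) -> om = 0.
Proof.
move=> phiC /(compatibleP _ phiC)[omZ omD] om_basis; apply/funext => x.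
have om0 : om 0 = 0.
  by have /esym/eqP := omD 0 0; rewrite addr0 -subr_eq0 addrK => /eqP.
rewrite [x]row_sum_delta (big_morph om omD om0) big1 // => i _.
by rewrite omZ om_basis mulr0.
Qed.

Lemma compatible0 phi : is_cochain2 phi -> compatible phi 0.
Proof.
move=> phiC; apply/(compatibleP _ phiC); split=> [a x|x y].
  by rewrite [LHS]/(0 : F) mulr0.
by rewrite [RHS]addr0.
Qed.

(** Zero is compatible with every cochain, hence is the only compatible map
    vanishing on the basis. *)
Lemma tilde_map_eq0 phi : is_cochain2 phi -> tilde_map (ba_x n charF) phi = 0.
Proof.
move=> phiC; rewrite /tilde_map; case: xgetP => // om _ [omC om_basis].
apply: (compatible_eq0 phiC omC) => i.
by have := om_basis i; rewrite tnth_mktuple.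
Qed.

(** The p-map is zero, and bracketing [p - 1 >= 2] times lands in the
    brackets with the center: the restrictedness condition on cocycles is
    empty. *)
Lemma ind2_eq0 phi om : is_cochain2 phi -> ind2 phi om = 0.
Proof.
move=> phiC; apply/funext => x; apply/funext => y; rewrite /ind2.
rewrite (cochain0r phiC) [lbracket _](_ : _ = 0) ?(cochain0l phiC) ?subr0 //.
rewrite /lbracket /=; case: p p_gt2 => [|[|[|q]]] //= _; rewrite ba_bracketA.
by elim: q => //= q IHq; rewrite ba_bracket0.
Qed.

(** Every term of the differential evaluates the form on a bracket, which is
    central; so forms with the center in their radical are cocycles. *)
Lemma cocycle_central phi om : is_cochain2 phi -> compatible phi om ->
  (forall x y z, phi (@bracket F G x y) z = 0) ->
  ((phi, om) : precochain2 G) \in @cocycle2_pred F p G.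
Proof.
move=> phiC omC phi0; apply/asboolP; split=> //.
rewrite /d2_res ind2_eq0 //; congr (_, _).
apply/funext => x; apply/funext => y; apply/funext => z; rewrite /d2.
do 3!rewrite big1 // => ? _.
by rewrite -[(phi, om).1]/phi !phi0 !mulr0 subr0 addr0.
Qed.

Lemma xx_cochain i j : is_cochain2 (xx_form i j : G -> G -> F^o).
Proof.
split=> [y a u v|x a u v|[] [] [x1 x2] [y1 y2] /eqP /= -> /eqP /= ->].
all: rewrite /xx_form /= ?mxE /GRing.scale /= ?mxE; ring.
Qed.

Lemma xy_cochain i j : is_cochain2 (xy_form i j : G -> G -> F^o).
Proof.
split=> [y a u v|x a u v|[] [] [x1 x2] [y1 y2] /eqP /= -> /eqP /= ->].
all: rewrite /xy_form /= ?mxE /GRing.scale /= ?mxE; ring.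
Qed.

Lemma yy_cochain i j : is_cochain2 (yy_form i j : G -> G -> F^o).
Proof.
split=> [y a u v|x a u v|[] [] [x1 x2] [y1 y2] /eqP /= -> /eqP /= ->].
all: rewrite /yy_form; case: eqP => _.
all: rewrite /= ?mxE /GRing.scale /= ?mxE; ring.
Qed.

Lemma with_tildeE phi : is_cochain2 phi -> with_tilde phi = (phi, 0).
Proof. by move=> phiC; rewrite /with_tilde tilde_map_eq0. Qed.

Lemma xx_cocycle i j : with_tilde (xx_form i j) \in @cocycle2_pred F p G.
Proof.
have phiC := xx_cochain i j; rewrite with_tildeE //.
apply: cocycle_central => // [|x y z]; first exact: compatible0.
by rewrite /xx_form /= !mxE !mul0r subr0.
Qed.

Lemma yy_cocycle (i j : 'I_n.+1) : (i < n)%N -> (j < n)%N ->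
  with_tilde (yy_form i j) \in @cocycle2_pred F p G.
Proof.
move=> /ltn_eqF ni /ltn_eqF nj; have phiC := yy_cochain i j.
rewrite with_tildeE //.
apply: cocycle_central => // [|x y z]; first exact: compatible0.
by rewrite /yy_form /= !mxE -!val_eqE /= ni nj !mulr0 !mul0r addr0 if_same.
Qed.

(** For [j < n] the center is in the radical.  For the central index [j = n]
    it is not, and the differential vanishes only in dimension [n = 1]: with a
    single even coordinate its terms cancel in pairs. *)
Lemma xy_cocycle (i : 'I_n) (j : 'I_n.+1) : (j < n)%N || (n == 1%N) ->
  with_tilde (xy_form i j) \in @cocycle2_pred F p G.
Proof.
have phiC := xy_cochain i j; rewrite with_tildeE // => nj.
have [jn|jn] := ltnP j n.
  apply: cocycle_central => // [|x y z]; first exact: compatible0.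
  by rewrite /xy_form /= !mxE -!val_eqE /= (ltn_eqF jn) !mulr0 !mul0r subr0.
move: nj; rewrite ltnNge jn /= => /eqP n1.
apply/asboolP; split; first by split=> //; apply: compatible0.
rewrite /d2_res ind2_eq0 //; congr (_, _).
apply/funext => x; apply/funext => y; apply/funext => z; rewrite /d2 !big_bool.
rewrite /xy_form /= !mxE /ba_form /=.
(* For n = 1 the form defining the bracket has a single term, that of i. *)
have bE (u v : 'rV[F]_n) (u' v' : 'rV[F]_n.+1) :
    \sum_(k < n) (u 0 k * v' 0 (yidx k) - v 0 k * u' 0 (yidx k))
    = u 0 i * v' 0 (yidx i) - v 0 i * u' 0 (yidx i).
  rewrite (bigD1 i) //= big1 ?addr0 // => k /eqP[]; apply/val_inj => /=.
  by have := ltn_ord k; have := ltn_ord i; lia.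
transitivity (0 : F) => //; rewrite !bE !mxE /=.
ring.
Qed.

Lemma xbar_cocycle i : ((0, xbar i) : precochain2 G) \in @cocycle2_pred F p G.
Proof.
have phiC : is_cochain2 (0 : G -> G -> F^o).
  have := cochain2_comb (-1) (xx_cochain i i) (xx_cochain i i).
  by rewrite scaleN1r addNr.
apply: cocycle_central => //; apply/compatibleP => //; split=> [a x|x y].
  by rewrite /xbar !mxE exprMn.
by rewrite /xbar mxE; apply: (pFrobenius_autD_comm charF); apply: mulrC.
Qed.

(** The differential of a linear form depends only on its value at the center,
    so the differential of this one spans the coboundaries. *)
Definition center_dual (u : G) : F^o := u.2 0 ord_max.
Fact center_dual_linear : linear center_dual.
Proof. by move=> a u v; rewrite /center_dual /= !mxE. Qed.
HB.instance Definition _ :=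
  GRing.isLinear.Build F G F^o _ center_dual center_dual_linear.

Lemma center_coboundary_cocycle :
  d1_res center_dual \in @cocycle2_pred F p G.
Proof.
have phiC : is_cochain2 (d1 center_dual).
  split=> [y a u v|x a u v|a b x y hx hy]; rewrite /d1.
  - by rewrite bracket_linear_l linearP.
  - by rewrite bracket_linear_r linearP.
  by rewrite (bracket_skew hx hy) linearN linearZ.
rewrite [d1_res _](_ : _ = (d1 center_dual, 0)); last first.
  by congr (_, _); apply/funext => x; apply: raddf0.
apply: cocycle_central => // [|x y z]; first exact: compatible0.
by rewrite /d1 [bracket _ _]ba_bracketA linear0.
Qed.

Definition cochain_of (t : cocycle_index n) : precochain2 G :=
  match t with
  | XX i j => with_tilde (xx_form i j) | YY i j => with_tilde (yy_form i j)
  | XB i => (0, xbar i) | XY i j => with_tilde (xy_form i j)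
  end.

Lemma map_cochain_of :
  [seq cochain_of t | t <- even_index n ++ odd_index n] = ba0_cocycles n charF.
Proof.
rewrite /even_index /odd_index /xy_pairs !map_cat -!catA.
rewrite -!(map_comp cochain_of).
rewrite /ba0_cocycles /xx_cocycles /yy_cocycles /xbar_cocycles /xy_cocycles.
by case: (n == 1%N); rewrite !map_allpairs.
Qed.


Lemma cochain_of_cocycle t : valid_index t ->
  cochain_of t \in @cocycle2_pred F p G.
Proof.
case: t => [i j|i j|i|i j] /= vt.
- exact: xx_cocycle.
- by apply: yy_cocycle; lia.
- exact: xbar_cocycle.
- by apply: xy_cocycle; move: vt; rewrite /independent_xy; lia.
Qed.

(** Labels that are not valid get the zero cocycle as a default value. *)
Definition index_cocycle t : cocycle2 G := insubd 0 (cochain_of t).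

Lemma val_index_cocycle t :
  valid_index t -> val (index_cocycle t) = cochain_of t.
Proof. by move=> vt; rewrite val_insubd cochain_of_cocycle. Qed.

Hypothesis n_gt0 : (0 < n)%N.

Fact last_subproof : (n.-1 < n)%N. Proof. by rewrite prednK. Qed.
(** The form dual to [x_n /\ y_n] is the one that is eliminated modulo the
    coboundary. *)
Definition last_i : 'I_n := Ordinal last_subproof.

Definition pivot (u : precochain2 G) : F^o :=
  u.1 (xbasis last_i) (ybasis (yidx last_i)).

Fact pivot_linear : linear pivot.
Proof. by move=> a [phi om] [psi th]. Qed.
HB.instance Definition _ :=
  GRing.isLinear.Build F (precochain2 G) F^o _ pivot pivot_linear.

(** Coordinates dual to the basis cocycles.  The value at [x_n, y_n] is
    subtracted from the other diagonal values so that all coordinates vanish on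
    the coboundary, the sum of the diagonal forms. *)
Definition precoord (t : cocycle_index n) (u : precochain2 G) : F^o :=
  match t with
  | XX i j => u.1 (xbasis i) (xbasis j)
  | YY i j => u.1 (ybasis i) (ybasis j)
  | XB i => u.2 (delta_mx 0 i : 'rV_n)
  | XY i j => u.1 (xbasis i) (ybasis j) - (j == yidx i)%:R * pivot u
  end.

Fact precoord_linear t : linear (precoord t).
Proof.
move=> a [phi om] [psi th].
have -> : a *: (phi, om) + (psi, th) = (a *: phi + psi, a *: om + th)
  :> precochain2 G by [].
case: t => [i j|i j|i|i j] //.
rewrite /precoord /pivot [LHS]/= !fctE; set c := _%:R.
rewrite /GRing.scale /=; ring.
Qed.
HB.instance Definition _ t :=
  GRing.isLinear.Build F (precochain2 G) F^o _ (precoord t) (precoord_linear t).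

Definition coord t : cocycle2 G -> F^o := precoord t \o val.
HB.instance Definition _ t := GRing.Linear.on (coord t).

Lemma coord_coboundary t u : H2_class u = 0 -> coord t u = 0.
Proof.
move=> u0; have /asboolP[psi uE] : u \in @coboundary2_pred F p G.
  by have [+ _] := H2_class_eq u 0; rewrite u0 raddf0 subr0 => ->.
case: t => [i j|i j|i|i j]; rewrite /coord /= uE ?/pivot /= ?/d1.
- by rewrite bracket_xx raddf0.
- by rewrite bracket_yy raddf0.
- by rewrite [LHS]raddf0.
rewrite !bracket_xy eqxx; case: eqP => _.
  by rewrite mul1r subrr.
by rewrite mul0r subr0 raddf0.
Qed.

Lemma precoord_dual t u : valid_index t -> valid_index u ->
  precoord t (cochain_of u) = (t == u)%:R.
Proof.
have XXE i j k l : (XX i j == XX k l :> cocycle_index n) = (i == k) && (j == l).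
  by [].
have YYE i j k l : (YY i j == YY k l :> cocycle_index n) = (i == k) && (j == l).
  by [].
have XBE i k : (XB i == XB k :> cocycle_index n) = (i == k) by [].
have XYE i j k l : (XY i j == XY k l :> cocycle_index n) = (i == k) && (j == l).
  by [].
case: u => [k l|k l|k|k l]; rewrite /cochain_of ?with_tildeE //;
  do ?[exact: xx_cochain | exact: yy_cochain | exact: xy_cochain];
  case: t => [i j|i j|i|i j] vt vu;
  rewrite ?XXE ?YYE ?XBE ?XYE /= /pivot /=
    /xx_form /yy_form /xy_form /xbar /= ?mxE ?eqxx
    ?(mulr0, mul0r, subr0, addr0) //=.
- rewrite -!natrM !mulnb (_ : (l == i) && (k == j) = false) ?subr0.
    by rewrite (eq_sym k) (eq_sym l).
  by apply/negP => /andP[/eqP li /eqP kj]; move: vt vu; rewrite /= li kj; lia.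
- by rewrite if_same.
- rewrite (eq_sym k i) (eq_sym l j); case: eqP vu => [<-|/eqP kl] vu.
    by rewrite -natrM mulnb (eq_sym k).
  rewrite -!natrM !mulnb (_ : (l == i) && (k == j) = false) ?addr0 //.
  apply/negP => /andP[/eqP li /eqP kj]; move: vt vu kl.
  by rewrite /= li kj -val_eqE /=; lia.
- by rewrite !if_same mulr0 subr0.
- rewrite eq_sym; case: eqP => _ /=; first by rewrite expr1n.
  by rewrite expr0n gtn_eqF // ltnW // ltnW.
rewrite -!natrM !mulnb (_ : (k == last_i) && (l == yidx last_i) = false).
  by rewrite andbF subr0 (eq_sym k) (eq_sym l).
apply/negP => /andP[/eqP kE /eqP lE]; move: vu.
by rewrite /= /independent_xy kE lE /=; lia.
Qed.

Lemma coord_dual t u : valid_index t -> valid_index u ->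
  coord t (index_cocycle u) = (t == u)%:R.
Proof.
by move=> vt vu; rewrite -(precoord_dual vt vu) -(val_index_cocycle vu).
Qed.

(** The cocycle condition does the work here: it forces the values that
    involve the center and are not coordinates to vanish.  The others are
    coordinates, up to symmetry and up to the pivot. *)
Lemma cocycle_eq0 (w : cocycle2 G) :
  (forall t, valid_index t -> coord t w = 0) ->
  pivot (val w) = 0 -> w = 0.
Proof.
move=> w0 w_last; apply: val_inj; have := valP w; move: w0 w_last.
rewrite /coord /=; move: (val w) => [phi om] w0 /= phi_last.
move=> /asboolP[[/= phiC omC] [d2phi _]]; have [phil phir phis] := phiC.
have phi0 : phi = 0; last first.
  have -> : om = 0; last by rewrite phi0.
  by apply: (compatible_eq0 phiC omC) => i; apply: (w0 (XB i)).
have d2E (a b c : bool) x y z : homog a x -> homog b y -> homog c z ->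
    phi (bracket x y) z - (-1) ^+ (c * b)%N * phi (bracket x z) y
    + (-1) ^+ (a * (b + c))%N * phi (bracket y z) x = 0.
  by move=> hx hy hz; rewrite -(d2_homog phiC hx hy hz) d2phi.
have hx := homog_x; have hy := homog_y.
have yyC i j : phi (ybasis i) (ybasis j) = phi (ybasis j) (ybasis i).
  by rewrite (phis _ _ _ _ (hy i) (hy j)) mulN1r opprK.
(* The condition on [x_i, y_i, y_k] says that the value at the center and y_k
   vanishes, up to a second such term when y_k is paired with x_i; for k < n
   take that i, so that the two terms are equal and characteristic 2 is the
   only obstruction. *)
have center_y k : phi (ybasis ord_max) (ybasis k) = 0.
  have [i ki] : exists i : 'I_n, (k < n)%N -> k = yidx i.
    have [kn|//] := ltnP k n; last by exists last_i.
    by exists (Ordinal kn) => _; apply: val_inj.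
  have := d2E _ _ _ _ _ _ (hx i) (hy (yidx i)) (hy k).
  rewrite bracket_yy (cochain0l phiC) mulr0 addr0 mulN1r opprK !bracket_xy eqxx.
  have [kE|_] := eqVneq k (yidx i); last by rewrite (cochain0l phiC) addr0.
  rewrite kE -mulr2n -mulr_natl => /eqP.
  by rewrite mulf_eq0 (negPf char_neq2) => /eqP.
apply: cochain_ext => // i j.
- have xxC : phi (xbasis i) (xbasis j) = - phi (xbasis j) (xbasis i).
    by rewrite (phis _ _ _ _ (hx i) (hx j)) mul1r.
  have [ij|ji|/val_inj ij] := ltngtP i j; first exact: (w0 (XX i j)).
    by rewrite xxC [X in - X](w0 (XX j i)) ?oppr0.
  move/eqP: xxC; rewrite ij -subr_eq0 opprK -mulr2n -mulr_natl mulf_eq0.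
  by rewrite (negPf char_neq2) => /eqP.
- have [vij|] := boolP (independent_xy n i j).
    by have := w0 (XY i j) vij; rewrite /= phi_last mulr0 subr0.
  rewrite /independent_xy negb_or => /andP[nind n1].
  have [jn|nj] := ltnP j n.
    have [<- <-] : last_i = i /\ yidx last_i = j.
      by split; apply: val_inj => /=; move: nind; rewrite jn /=; lia.
    exact: phi_last.
  have -> : j = ord_max by apply: val_inj => /=; have := ltn_ord j; lia.
  (* Only the value at x_i and the center is left, with n > 1: the condition
     on x_i, x_k, y_k isolates it for any k != i. *)
  have [k ki] : exists k : 'I_n, k != i.
    have n2 : (1 < n)%N by have := ltn_ord j; lia.
    have [i0|i0] := eqVneq (i : nat) 0%N.
      by exists (Ordinal n2); rewrite -val_eqE /= i0.
    by exists (Ordinal n_gt0); rewrite -val_eqE /= eq_sym.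
  have := d2E _ _ _ _ _ _ (hx i) (hx k) (hy (yidx k)).
  rewrite bracket_xx !bracket_xy eqxx (_ : (yidx k == yidx i) = false).
    rewrite !(cochain0l phiC) mulr0 subr0 add0r mul1r => zx.
    by rewrite (phis _ _ _ _ (hx i) (hy ord_max)) zx mulr0 oppr0.
  by rewrite -val_eqE /= val_eqE (negPf ki).
have [in_|/eqP iE] : (i < n)%N \/ i == ord_max.
  by rewrite -val_eqE /=; have := ltn_ord i; lia.
  have [jn|/eqP jE] : (j < n)%N \/ j == ord_max.
    by rewrite -val_eqE /=; have := ltn_ord j; lia.
    have [ij|/ltnW ji] := leqP i j; last rewrite yyC.
      by apply: (w0 (YY i j)); rewrite /= ij jn.
    by apply: (w0 (YY j i)); rewrite /= ji in_.
  by rewrite jE yyC center_y.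
by rewrite iE center_y.
Qed.

Definition center_coboundary : cocycle2 G :=
  Cocycle2 center_coboundary_cocycle.

Lemma center_coboundary_class : H2_class center_coboundary = 0.
Proof.
rewrite -(raddf0 (@H2_class F p G)); apply/H2_class_eq; rewrite subr0.
by apply/asboolP; exists center_dual.
Qed.


Lemma pivot_index_cocycle t :
  valid_index t -> pivot (val (index_cocycle t)) = 0.
Proof.
move=> vt; rewrite val_index_cocycle //.
case: t vt => [k l|k l|k|k l] vt; rewrite /cochain_of ?with_tildeE //;
  do ?[exact: xx_cochain | exact: yy_cochain | exact: xy_cochain];
  rewrite /pivot /= /xx_form /yy_form /xy_form /= ?mxE ?eqxx
    ?(mulr0, mul0r, subr0, addr0) ?if_same //=.
rewrite -natrM mulnb [_ && _](_ : _ = false) //.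
apply/negP => /andP[/eqP kE /eqP lE].
by move: vt; rewrite /= /independent_xy kE lE /=; lia.
Qed.

Lemma pivot_center_coboundary : pivot (val center_coboundary) = 1.
Proof.
rewrite /pivot /= /d1 bracket_xy eqxx [LHS]/(center_dual _) /center_dual.
by rewrite mxE !eqxx.
Qed.

(** Subtracting from a cocycle its coordinates and its pivot times the
    coboundary leaves a cocycle with all coordinates and the pivot zero. *)
Lemma class_expansion (v : cocycle2 G) :
  H2_class v = \sum_(t <- even_index n ++ odd_index n)
                 (coord t v : F) *: H2_class (index_cocycle t).
Proof.
set s := _ ++ _.
have vs t : t \in s -> valid_index t by rewrite mem_index.
pose z := \sum_(t <- s) (coord t v : F) *: index_cocycle t.
pose w := v - z - (pivot (val v) : F) *: center_coboundary.
suff w0 : w = 0.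
  have : H2_class w = 0 by rewrite w0 raddf0.
  have -> : H2_class w = H2_class v - H2_class z
      - (pivot (val v) : F) *: H2_class center_coboundary.
    by rewrite /w !raddfB; congr (_ - _); apply: H2_classZ.
  rewrite center_coboundary_class scaler0 subr0 => /eqP.
  rewrite subr_eq0 => /eqP ->; rewrite /z raddf_sum.
  by apply: eq_bigr => t _; apply: H2_classZ.
have coordZ t (a : F) u : coord t (a *: u) = a * coord t u by exact: linearZ.
have coordB t u u' : coord t (u - u') = coord t u - coord t u'.
  exact: raddfB.
have pivotZ (a : F) u : pivot (val (a *: u)) = a * pivot (val u).
  by rewrite linearZ; apply: linearZ.
have pivotB u u' : pivot (val (u - u')) = pivot (val u) - pivot (val u').
  by rewrite raddfB; apply: raddfB.
apply: cocycle_eq0 => [t vt|].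
  rewrite /w !coordB coordZ (coord_coboundary t center_coboundary_class).
  rewrite mulr0 subr0 /z (raddf_sum (coord t)).
  rewrite (bigD1_seq t) /= ?mem_index ?uniq_index //.
  rewrite coordZ coord_dual // eqxx mulr1 big1_seq ?addr0 ?subrr // => u.
  case/andP=> ut /vs vu; rewrite coordZ coord_dual // eq_sym (negPf ut).
  exact: mulr0.
rewrite /w !pivotB pivotZ pivot_center_coboundary mulr1.
rewrite [pivot (val z)](_ : _ = 0).
  by rewrite subr0 subrr.
rewrite /z !raddf_sum big1_seq // => t /andP[_ /vs vt].
by rewrite [LHS]pivotZ pivot_index_cocycle // mulr0.
Qed.

Lemma cochain_of_parity t : valid_index t ->
  has_parity (index_parity t) (cochain_of t).
Proof.
case: t => [i j|i j|i|i j] _; rewrite /cochain_of.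
- rewrite with_tildeE; last exact: xx_cochain.
  move=> [] [] [x1 x2] [y1 y2] /eqP /= -> /eqP /= -> _ //.
    by rewrite /xx_form /= !mxE !mul0r subr0.
  by rewrite /xx_form /= !mxE !mulr0 subr0.
- rewrite with_tildeE; last exact: yy_cochain.
  move=> [] [] [x1 x2] [y1 y2] /eqP /= -> /eqP /= -> _ //.
    by rewrite /yy_form /= !mxE !mulr0 addr0 if_same.
  by rewrite /yy_form /= !mxE !mul0r addr0 if_same.
- by [].
rewrite with_tildeE; last exact: xy_cochain.
split=> // -[] [] [x1 x2] [y1 y2] /eqP /= -> /eqP /= -> _ //.
  by rewrite /xy_form /= !mxE mul0r mulr0 subr0.
by rewrite /xy_form /= !mxE mul0r mulr0 subr0.
Qed.

Lemma coord_parity b t (v : cocycle2 G) :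
  has_parity b (val v) -> index_parity t != b -> coord t v = 0.
Proof.
rewrite /coord /=; move: (val v) => [phi om].
have hx := homog_x; have hy := homog_y.
case: b => [[/= phi_odd om0]|/= phi_even]; case: t => [i j|i j|i|i j] //= _.
- by rewrite (phi_odd _ _ _ _ (hx i) (hx j)).
- by rewrite (phi_odd _ _ _ _ (hy i) (hy j)).
- by rewrite om0.
by rewrite /pivot /= !(phi_even _ _ _ _ (hx _) (hy _)) // mulr0 subr0.
Qed.

(** A common statement for the two homogeneous parts and for the whole
    cohomology: if the coordinates outside [s] vanish on representatives of the
    elements of [W], the expansion of these elements only involves [s]. *)
Lemma classes_basis (W : set (H2_res G)) (s : seq (cocycle_index n)) :
  uniq s -> {subset s <= @valid_index n} ->
  {in s, forall t, W (H2_class (index_cocycle t))} ->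
  (forall h, W h -> exists2 v, h = H2_class v &
     forall t, valid_index t -> t \notin s -> coord t v = 0) ->
  is_basis W [seq H2_class (index_cocycle t) | t <- s].
Proof.
move=> us vs Ws Wv.
apply: (@dual_basis F (cocycle2 G) (H2_res G) (@H2_class F p G) _
  index_cocycle (fun t => coord t : {linear cocycle2 G -> F^o})) => //.
- by move=> t v; apply: coord_coboundary.
- by move=> t u /vs vt /vs vu; apply: coord_dual.
move=> _ /Wv[v -> v0]; exists v => //; rewrite class_expansion.
rewrite (bigID (mem s)) /= [X in _ + X]big1_seq ?addr0; last first.
  by move=> t /andP[ts]; rewrite mem_index => vt; rewrite v0 // scale0r.
rewrite -big_filter; apply: perm_big; apply: uniq_perm => //.
  exact/filter_uniq/uniq_index.
move=> t; rewrite mem_filter mem_index /=.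
by case: (boolP (t \in s)) => //= /vs.
Qed.

Lemma part_basis b :
  is_basis (H2_part (g := G) b) [seq H2_class (index_cocycle t)
    | t <- if b then odd_index n else even_index n].
Proof.
have mem_s t : (t \in if b then odd_index n else even_index n)
    = valid_index t && (index_parity t == b).
  by case: b; rewrite ?mem_odd_index ?mem_even_index; case: index_parity.
apply: classes_basis => [|t|t|_ [v [vb ->]]]; rewrite ?mem_s.
- by have := uniq_index n; rewrite cat_uniq => /and3P[]; case: (b).
- by case/andP.
- case/andP=> vt /eqP <-; exists (index_cocycle t); split=> //.
  by rewrite val_index_cocycle //; apply: cochain_of_parity.
exists v => // t vt; rewrite mem_s vt /=; exact: coord_parity.
Qed.

End Heisenberg.

Theorem theorem4p2 (F : closedFieldType) (p : nat) (charF : p \in [pchar F])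
    (p_gt2 : (2 < p)%N) (n : nat) (n_gt0 : (0 < n)%N) :
  sdim_H2_res_is (ba0 n charF)
    ((n ^ 2 + n)%N, (n ^ 2 - 1 + (n == 1%N))%N) /\
  exists z : seq (cocycle2 (ba0 n charF)),
    [seq val u | u <- z] = ba0_cocycles n charF /\
    is_basis [set: H2_res (ba0 n charF)] [seq H2_class u | u <- z].
Proof.
split; first split.
- exists [seq H2_class (index_cocycle charF t) | t <- even_index n].
  by split; [rewrite size_map size_even_index |
             apply: (part_basis _ _ _ false)].
- exists [seq H2_class (index_cocycle charF t) | t <- odd_index n].
  by split; [rewrite size_map size_odd_index |
             apply: (part_basis _ _ _ true)].
exists [seq index_cocycle charF t | t <- even_index n ++ odd_index n]; split.
  rewrite -map_cochain_of -map_comp; apply/eq_in_map => t.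
  by rewrite mem_index => vt; apply: val_index_cocycle.
rewrite -map_comp; apply: classes_basis => //.
- exact: uniq_index.
- by move=> t; rewrite mem_index.
move=> h _; exists (repr h); first by rewrite H2_classK.
by move=> t vt; rewrite mem_index vt.
Qed.
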